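(* Let $(M_n)_{n\ge 0}$ be a nonnegative supermartingale with respect to a filtration $(\mathcal{F}_n)_{n\ge 0}$, with $M_0=1$, let $b>1$, and let $T_b=\inf\{n\ge 1: M_n\ge b\}$. Suppose that $M_n\to0$ almost surely on the event $\{T_b=\infty\}$, that the family $\{M_n\mathbf{1}(T_b>n)\}_{n}$ is uniformly integrable, and that $O_b<\infty$. Then $$\mathbb{E}[M_{T_b}\mathbf{1}(T_b<\infty)]=1-D_b,$$ and consequently $$\mathbb{P}(T_b<\infty)=\frac{1-D_b}{b+O_b}.$$
   Context: A nonnegative adapted process $(M_n,\mathcal{F}_n)_{n\ge0}$ with $\mathbb{E}[M_n]<\infty$ for all $n$ is a supermartingale if $\mathbb{E}[M_n\mid\mathcal{F}_{n-1}]\le M_{n-1}$ almost surely for every $n\ge1$. Convention: $\inf\varnothing=\infty$. The decrement at time $n\ge1$ is $\delta_n=M_{n-1}-\mathbb{E}[M_n\mid\mathcal{F}_{n-1}]\ge0$. The supermartingale loss is $D_b=\sum_{i=1}^\infty\mathbb{E}[\delta_i\mathbf{1}(T_b\ge i)]$. The expected overshoot is $O_b=\mathbb{E}[M_{T_b}-b\mid T_b<\infty]$, with the convention $O_b=0$ if $\mathbb{P}(T_b<\infty)=0$. *)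

(* Defs.v *)
From HB Require Import structures.
From mathcomp Require Import all_boot all_order all_algebra.
From mathcomp Require Import all_classical all_reals all_analysis.
From mathcomp Require Import measurable_realfun.

Set Implicit Arguments.
Unset Strict Implicit.
Unset Printing Implicit Defensive.

Import Order.TTheory GRing.Theory Num.Theory.
Import numFieldNormedType.Exports.

Local Open Scope classical_set_scope.
Local Open Scope ring_scope.

Definition sub_sigma_algebra_of d (T : measurableType d) (G : set (set T)) :=
  sigma_algebra setT G /\ G `<=` measurable.

Definition measurable_wrt d (T : measurableType d) (R : realType)
    (G : set (set T)) (X : T -> R) :=
  measurable_fun [set: g_sigma_algebraType G] (X : g_sigma_algebraType G -> R).

Section conditional_expectation.
Context d (T : measurableType d) (R : realType) (P : probability T R).
Local Open Scope ereal_scope.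

Definition is_cond_exp (G : set (set T)) (X Y : T -> R) : Prop :=
  [/\ measurable_wrt G Y,
      P.-integrable setT (EFin \o Y) &
      forall A, G A -> \int[P]_(w in A) (Y w)%:E = \int[P]_(w in A) (X w)%:E].

(* An arbitrary version, picked by choice; `cond_expP` shows that one exists
   and `is_cond_exp_unique` that all versions agree almost surely. *)
Definition cond_exp (G : set (set T)) (X : T -> R) : T -> R :=
  xget (cst 0%R) [set Y | is_cond_exp G X Y].

End conditional_expectation.

Section process.
Context d (T : measurableType d) (R : realType) (P : probability T R).
Local Open Scope ereal_scope.

Definition filtration (F : nat -> set (set T)) : Prop :=
  (forall n, sub_sigma_algebra_of (F n)) /\
  (forall m n, (m <= n)%N -> F m `<=` F n).

Definition adapted (F : nat -> set (set T)) (M : nat -> T -> R) : Prop :=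
  forall n, measurable_wrt (F n) (M n).

Record nonneg_supermartingale (F : nat -> set (set T)) (M : nat -> T -> R)
  : Prop := NonnegSupermartingale {
  supermartingale_filtration : filtration F ;
  supermartingale_adapted : adapted F M ;
  supermartingale_ge0 : forall n w, (0 <= M n w)%R ;
  supermartingale_expectation : forall n, 'E_P[M n] < +oo ;
  supermartingale_le : forall n, (1 <= n)%N ->
    {ae P, forall w, (cond_exp P (F n.-1) (M n) w <= M n.-1 w)%R} }.

(* Meaningful for 1 <= n only. *)
Definition decrement (F : nat -> set (set T)) (M : nat -> T -> R) (n : nat)
    (w : T) : R :=
  (M n.-1 w - cond_exp P (F n.-1) (M n) w)%R.

(* +oo when M never reaches b, since `ereal_inf set0 = +oo`. *)
Definition crossing_time (M : nat -> T -> R) (b : R) (w : T) : \bar R :=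
  ereal_inf [set n%:R%:E | n in [set n : nat | (1 <= n)%N /\ (b <= M n w)%R]].

(* The value M_tau; junk where tau = +oo. *)
Definition stopped (M : nat -> T -> R) (tau : T -> \bar R) (w : T) : R :=
  M (Num.truncn (fine (tau w))) w.

Definition uniformly_integrable (I : Type) (X : I -> T -> R) : Prop :=
  ereal_sup
    (range (fun i =>
      'E_P[fun w => (`|X i w| * \1_[set v | K < `|X i v|] w)%R]))
    @[K --> +oo%R] --> 0.

Definition expectation_given (A : set T) (X : T -> R) : \bar R :=
  if P A == 0 then 0 else 'E_P[fun w => (X w * \1_A w)%R] / P A.

Definition loss (F : nat -> set (set T)) (M : nat -> T -> R) (b : R) : \bar R :=
  \sum_(1 <= i <oo)
    'E_P[fun w => (decrement F M i w *
                   \1_[set v | (i%:R%:E <= crossing_time M b v)%E] w)%R].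

Definition overshoot (M : nat -> T -> R) (b : R) : \bar R :=
  expectation_given [set w | crossing_time M b w < +oo]
    (fun w => stopped M (crossing_time M b) w - b)%R.

End process.

Section conditional_expectation_theory.
Context d (T : measurableType d) (R : realType) (P : probability T R).
Variable G : set (set T).
Hypothesis sG : sub_sigma_algebra_of G.
Local Open Scope ereal_scope.

Let measurableG (A : set T) : G.-sigma.-measurable A = G A.
Proof. by rewrite measurable_g_measurableTypeE //; case: sG. Qed.

Let toG (w : T) : g_sigma_algebraType G := w.

Let mtoG : measurable_fun [set: T] toG.
Proof. by move=> _ B mB; rewrite setTI; apply: sG.2; rewrite -measurableG. Qed.

HB.instance Definition _ := isMeasurableFun.Build _ _ _ _ toG mtoG.

Lemma measurable_wrt_measurable (X : T -> R) :
  measurable_wrt G X -> measurable_fun [set: T] X.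
Proof.
move=> mX _ B mB; apply: sG.2; rewrite -measurableG; exact: mX.
Qed.

Lemma is_cond_exp_unique (X Y Z : T -> R) :
  is_cond_exp P G X Y -> is_cond_exp P G X Z -> {ae P, forall w, Y w = Z w}.
Proof.
move=> [mY iY YE] [mZ iZ ZE].
pose Q : {measure set (g_sigma_algebraType G) -> \bar R} := distribution P toG.
pose EY : g_sigma_algebraType G -> \bar R := EFin \o Y.
pose EZ : g_sigma_algebraType G -> \bar R := EFin \o Z.
have mEY : measurable_fun [set: g_sigma_algebraType G] EY.
  exact/measurable_EFinP.
have mEZ : measurable_fun [set: g_sigma_algebraType G] EZ.
  exact/measurable_EFinP.
have QE (f : g_sigma_algebraType G -> \bar R) A : G A ->
    measurable_fun [set: g_sigma_algebraType G] f ->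
    P.-integrable setT (f : T -> \bar R) ->
    \int[Q]_(w in A) f w = \int[P]_(w in (A : set T)) f w.
  move=> GA mf intf; rewrite (integral_pushforward mtoG mf)//.
    by apply: integrableS intf => //; apply: sG.2.
  by rewrite measurableG.
have iQ : Q.-integrable setT EY.
  exact: (integrable_pushforward mtoG mEY iY).
have [N [mN N0 sN]] : ae_eq Q setT EY EZ.
  apply: integral_ae_eq => // E _; rewrite measurableG => GE.
  by rewrite !QE// YE// ZE.
exists N; split => //.
  by apply: sG.2; rewrite -measurableG.
by move=> w /= YZ; apply: sN => /= /(_ I) [].
Qed.

Lemma is_cond_exp_exists (X : T -> R) : P.-integrable setT (EFin \o X) ->
  exists Y, is_cond_exp P G X Y.
Proof.
move=> iX.
pose Q : {finite_measure set (g_sigma_algebraType G) -> \bar R} :=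
  distribution P toG.
pose nu := @measure_function_pushforward__canonical__charge_Charge
  _ _ _ _ toG R (induced_charge iX) mtoG.
have nuQ : nu `<< Q.
  apply/null_content_dominatesP => A; rewrite measurableG => GA QA.
  have mA : d.-measurable A by exact: sG.2.
  rewrite /nu /= /pushforward /induced_charge.
  apply: null_set_integral => //.
  exact: measurable_funTS (measurable_int _ iX).
have iY := Radon_Nikodym_integrable nuQ.
have fY w : Radon_Nikodym nu Q w \is a fin_num by exact: Radon_Nikodym_fin_num.
have mRN : measurable_fun [set: g_sigma_algebraType G] (Radon_Nikodym nu Q).
  exact: measurable_int iY.
have YE : EFin \o (fine \o Radon_Nikodym nu Q) = Radon_Nikodym nu Q.
  by apply/funext => w /=; rewrite fineK.
have iPY : P.-integrable setT (Radon_Nikodym nu Q : T -> \bar R).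
  apply/integrableP; split.
    exact: (measurableT_comp mRN mtoG).
  have /integrableP[_] := iY.
  rewrite ge0_integral_pushforward//.
  by apply: measurableT_comp.
exists (fine \o Radon_Nikodym nu Q); split.
- by apply/measurable_EFinP; rewrite YE.
- by rewrite YE.
move=> A GA.
transitivity (nu A) => //.
rewrite (Radon_Nikodym_integral nuQ) ?measurableG//.
rewrite (integral_pushforward mtoG mRN) ?measurableG//.
  by apply: eq_integral => w _ /=; rewrite fineK.
by apply: integrableS iPY => //; exact: sG.2.
Qed.

Lemma cond_expP (X : T -> R) : P.-integrable setT (EFin \o X) ->
  is_cond_exp P G X (cond_exp P G X).
Proof. by move=> /is_cond_exp_exists; exact: xgetPex. Qed.

End conditional_expectation_theory.

Section crossing_time_theory.
Context d (T : measurableType d) (R : realType).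
Variables (M : nat -> T -> R) (b : R).
Local Open Scope ereal_scope.

Lemma crossing_time_pinftyP w : crossing_time M b w = +oo <->
  (forall n, (1 <= n)%N -> (M n w < b)%R).
Proof.
split=> [+ n n1|h].
- rewrite ltNge => /ereal_inf_pinfty hinf; apply/negP => bM.
  suff : n%:R%:E = +oo :> \bar R by [].
  by apply: hinf; exists n.
- rewrite /crossing_time (_ : [set _ | _ in _] = set0) ?ereal_inf0//.
  by rewrite -subset0 => x [n [n1 +] _]; rewrite leNgt h.
Qed.

Lemma crossing_time_finP w n : crossing_time M b w = n%:R%:E <->
  [/\ (1 <= n)%N, (b <= M n w)%R &
      forall k, (1 <= k < n)%N -> (M k w < b)%R].
Proof.
have first m : (1 <= m)%N -> (b <= M m w)%R ->
    (forall k, (1 <= k < m)%N -> (M k w < b)%R) ->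
    crossing_time M b w = m%:R%:E.
  move=> m1 bM hm; apply/eqP; rewrite eq_le; apply/andP; split.
    by apply: ereal_inf_lbound; exists m.
  apply: le_ereal_inf_tmp => _ [k [k1 bMk] <-]; rewrite lee_fin ler_nat leqNgt.
  by apply/negP => km; move: bMk; rewrite leNgt hm// k1 km.
split=> [cn|[]]; last exact: first.
have /existsNP[m] : ~ (forall n, (1 <= n)%N -> (M n w < b)%R).
  by move=> /crossing_time_pinftyP; rewrite cn.
move=> /not_implyP[m1 /negP]; rewrite -leNgt => bMm.
have ex : exists k, (1 <= k)%N && (b <= M k w)%R by exists m; rewrite m1.
have [k /andP[k1 bMk] kmin] := ex_minnP ex.
have hk j : (1 <= j < k)%N -> (M j w < b)%R.
  move=> /andP[j1 jk]; rewrite ltNge; apply/negP => bMj.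
  by have := kmin j; rewrite j1 bMj leqNgt jk => /(_ isT).
have := first k k1 bMk hk; rewrite cn => -[] /eqP; rewrite eqr_nat => /eqP ->.
by split.
Qed.

Lemma stoppedE w n (tau : T -> \bar R) : tau w = n%:R%:E ->
  stopped M tau w = M n w.
Proof. by rewrite /stopped => ->; rewrite /= natrK. Qed.

End crossing_time_theory.

(* Main.v *)
Require Import Defs.
From HB Require Import structures.
From mathcomp Require Import all_boot all_order all_algebra.
From mathcomp Require Import all_classical all_reals all_analysis.
From mathcomp Require Import measurable_realfun.
From mathcomp Require Import ring.

Set Implicit Arguments.
Unset Strict Implicit.
Unset Printing Implicit Defensive.

Import Order.TTheory GRing.Theory Num.Theory.
Import numFieldNormedType.Exports.

Local Open Scope classical_set_scope.
Local Open Scope ring_scope.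
Local Open Scope ereal_scope.

(** The mass held at time n on {n < T}, with T = T_b, is either carried over to
    {n+1 < T}, released at the value M_{n+1} on {T = n+1}, or lost:
    {T >= n+1} = {n < T} belongs to F_n, so conditioning on F_n gives

      E[M_n 1(n < T)] = E[M_{n+1} 1(n+1 < T)] + E[M_{n+1} 1(T = n+1)]
                        + E[delta_{n+1} 1(T >= n+1)]

    ([stopping_balance]).  Telescoping from E[M_0] = 1 ([loss_balance]), the
    first n losses add up to 1 minus the mass released by time n minus the
    residual E[M_n 1(n < T)].  The released masses sum to E[M_T 1(T < oo)]
    ([expectation_stopped_series]).  The residual vanishes: M_n 1(n < T) tends
    to 0 almost surely, because M_n -> 0 where T = oo and the indicator is
    eventually 0 elsewhere, and uniform integrability turns this into
    convergence in mean ([uniformly_integrable_cvg0]).  Hence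
    D_b = 1 - E[M_T 1(T < oo)].

    For the crossing probability, splitting M_T = b + (M_T - b) gives
    E[M_T 1(T < oo)] = P(T < oo) (b + O_b)
    ([expectation_stopped_overshoot]).  When O_b is finite this makes
    E[M_T 1(T < oo)] finite, so that the limit above involves no difference of
    infinities, and the positive real b + O_b can be divided out. *)

(** * Uniform integrability and convergence in mean *)

Section expectation_auxiliaries.
Context d (T : measurableType d) (R : realType) (P : probability T R).

Lemma expectation_mul_indic (A : set T) (X : T -> R) :
  'E_P[fun w => (X w * \1_A w)%R] = \int[P]_(w in A) (X w)%:E.
Proof.
by rewrite unlock [RHS]integral_mkcond epatch_indic.
Qed.

(** One direction of Vitali's theorem.  A level K splits |X_n| into
    min(|X_n|, K), whose mean tends to 0 by dominated convergence since P is
    finite, and a tail whose mean is small uniformly in n. *)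
Lemma uniformly_integrable_cvg0 (X : nat -> T -> R) :
  (forall n, measurable_fun [set: T] (X n)) ->
  uniformly_integrable P X ->
  {ae P, forall w, X n w @[n --> \oo] --> (0 : R)%R} ->
  'E_P[fun w => `|X n w|%R] @[n --> \oo] --> 0.
Proof.
move=> mX UI X0.
have mabs n : measurable_fun [set: T] (fun w => `|X n w|%R).
  exact: measurableT_comp.
(* It is enough to bound the means: they are nonnegative, and an eventual
   finite bound makes them real numbers. *)
suff small (eps : R) : (0 < eps)%R ->
    \forall n \near \oo, 'E_P[fun w => `|X n w|%R] <= eps%:E.
  have abs_ge0 n : 0 <= 'E_P[fun w => `|X n w|%R] by exact: expectation_ge0.
  apply/fine_cvgP; split.
    apply: filterS (small _ ltr01) => n En; rewrite ge0_fin_numE//.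
    by rewrite (le_lt_trans En)// ltry.
  apply/cvgr0Pnorm_le => eps e0.
  apply: filterS (small _ e0) => n En /=.
  rewrite ger0_norm ?fine_ge0// -lee_fin fineK// ge0_fin_numE//.
  by rewrite (le_lt_trans En)// ltry.
move=> e0.
have [K [K0 tail]] : exists K : R, (0 <= K)%R /\ forall n,
    'E_P[fun w => (`|X n w| * \1_[set v | K < `|X n v|] w)%R]
      <= (eps / 2)%:E.
  have /fine_cvgP[fin /cvgr0Pnorm_le/(_ (eps / 2)%R)] := UI.
  rewrite divr_gt0// => /(_ isT) le.
  have : \forall K \near +oo%R, (0 <= K :> R)%R by exact: nbhs_pinfty_ge.
  move=> ge0.
  have [K [/= Kfin [Kle K0]]] :=
    @filter_ex _ _ _ _ (filterI fin (filterI le ge0)).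
  exists K; split => // n.
  apply: (@le_trans _ _ (ereal_sup (range (fun i =>
      'E_P[fun w => (`|X i w| * \1_[set v | K < `|X i v|] w)%R])))).
    by apply: ereal_sup_ubound; exists n.
  by rewrite -[leLHS]fineK// lee_fin; exact: le_trans (ler_norm _) Kle.
have mmin n : measurable_fun [set: T] (fun w => Num.min `|X n w|%R K).
  exact: measurable_minr.
have mtail n : measurable [set w | (K < `|X n w|)%R].
  have := mabs n measurableT _ (@measurable_itv R `]K, +oo[).
  by rewrite setTI preimage_itvoy.
have trunc : \int[P]_w (Num.min `|X n w|%R K)%:E @[n --> \oo] --> 0.
  have [] := @dominated_convergence _ _ _ P _ measurableT
    (fun n w => (Num.min `|X n w|%R K)%:E) (cst 0) (cst K%:E).
  - by move=> n; exact/measurable_EFinP.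
  - exact: measurable_cst.
  - apply: filterS X0 => w Xw _ /=.
    apply: cvg_EFin; first exact: nearW.
    apply: (@squeeze_cvgr _ _ _ _ (cst 0%R) (fun n => `|X n w|%R)).
    + by apply: nearW => n /=; rewrite le_min normr_ge0 K0/= ge_min lexx.
    + exact: cvg_cst.
    + by rewrite -(@normr0 _ R); exact: cvg_norm.
  - exact: finite_measure_integrable_cst.
  - apply: aeW => w n _ /=; rewrite lee_fin ger0_norm ?ge_min ?lexx ?orbT//.
    by rewrite le_min normr_ge0.
  by rewrite integral0.
have /fine_cvgP[fin /cvgr0Pnorm_le/(_ (eps / 2)%R)] := trunc.
rewrite divr_gt0// => /(_ isT) le.
apply: filterS2 fin le => n /= nfin nle.
have min_ge0 w : (0 <= Num.min `|X n w| K)%R by rewrite le_min normr_ge0.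
have min_le : \int[P]_w (Num.min `|X n w|%R K)%:E <= (eps / 2)%:E.
  by rewrite -[leLHS]fineK// lee_fin; exact: le_trans (ler_norm _) nle.
have mXtail : measurable_fun [set: T]
    (fun w => (`|X n w| * \1_[set v | K < `|X n v|] w)%R).
  by apply: measurable_funM => //; exact: measurable_indic.
apply: (@le_trans _ _ (\int[P]_w ((Num.min `|X n w|%R K)%:E +
    (`|X n w| * \1_[set v | K < `|X n v|] w)%R%:E))).
  rewrite unlock; apply: ge0_le_integral => //.
  - exact/measurable_EFinP.
  - by apply: emeasurable_funD; exact/measurable_EFinP.
  - move=> w _; rewrite -EFinD lee_fin indicE.
    have [KX|XK] := ltrP K `|X n w|.
      by rewrite mem_set//= mulr1 lerDr.
    by rewrite lerDl mulr_ge0.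
rewrite ge0_integralD//.
- rewrite [leRHS](_ : _ = (eps / 2)%:E + (eps / 2)%:E); last first.
    by rewrite -EFinD -splitr.
  by apply: leeD => //; have := tail n; rewrite unlock.
- by move=> w _; rewrite lee_fin.
- exact/measurable_EFinP.
- exact/measurable_EFinP.
Qed.

End expectation_auxiliaries.

(** * The events that determine the crossing time *)

Section crossing_events.
Context d (T : measurableType d) (R : realType).
Variables (M : nat -> T -> R) (b : R).

Lemma crossing_time_gtP n w : n%:R%:E < crossing_time M b w <->
  (forall k, (1 <= k <= n)%N -> (M k w < b)%R).
Proof.
split=> [nT k /andP[k1 kn]|below].
  rewrite ltNge; apply/negP => bMk; move: nT; rewrite ltNge => /negP; apply.
  apply: (@le_trans _ _ k%:R%:E); last by rewrite lee_fin ler_nat.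
  by apply: ereal_inf_lbound; exists k.
apply: (@lt_le_trans _ _ n.+1%:R%:E); first by rewrite lte_fin ltr_nat.
apply: le_ereal_inf_tmp => _ [k [k1 bMk] <-]; rewrite lee_fin ler_nat ltnNge.
by apply/negP => kn; move: bMk; rewrite leNgt below// k1.
Qed.

Lemma crossing_time_geS n w :
  (n.+1%:R%:E <= crossing_time M b w) = (n%:R%:E < crossing_time M b w).
Proof.
apply/idP/idP; first by apply: lt_le_trans; rewrite lte_fin ltr_nat.
move=> /crossing_time_gtP below.
apply: le_ereal_inf_tmp => _ [k [k1 bMk] <-]; rewrite lee_fin ler_nat ltnNge.
by apply/negP => kn; move: bMk; rewrite leNgt below// k1.
Qed.

(** The next two lemmas split {n < T} according to whether M_{n+1} stays below
    b, and give both the measurability of the events of T and the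
    decomposition behind the one-step balance. *)
Lemma crossing_time_gtS n : [set w | n.+1%:R%:E < crossing_time M b w] =
  [set w | n%:R%:E < crossing_time M b w] `&` [set w | (M n.+1 w < b)%R].
Proof.
apply/seteqP; split=> w /=.
  move=> /crossing_time_gtP below; split; last by apply: below; rewrite leqnn.
  apply/crossing_time_gtP => k /andP[k1 kn]; apply: below.
  by rewrite k1 ltnW.
move=> [/crossing_time_gtP below Mb]; apply/crossing_time_gtP => k.
move=> /andP[k1]; rewrite leq_eqVlt => /orP[/eqP->//|kn].
by apply: below; rewrite k1.
Qed.

Lemma crossing_time_eqS n : [set w | crossing_time M b w = n.+1%:R%:E] =
  [set w | n%:R%:E < crossing_time M b w] `&` [set w | (b <= M n.+1 w)%R].
Proof.
apply/seteqP; split=> w /=.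
  move=> /crossing_time_finP[_ bM below]; split=> //.
  by apply/crossing_time_gtP => k; exact: below.
move=> [/crossing_time_gtP below bM]; by apply/crossing_time_finP.
Qed.

Lemma crossing_time_ltyE : [set w | crossing_time M b w < +oo] =
  \bigcup_n [set w | crossing_time M b w = n.+1%:R%:E].
Proof.
apply/seteqP; split=> w /=; last by move=> [n _ ->]; exact: ltry.
move=> Tfin; apply: contrapT => noT.
suff : crossing_time M b w = +oo by move=> Ty; rewrite Ty ltxx in Tfin.
apply/crossing_time_pinftyP => n n1.
suff nT : n%:R%:E < crossing_time M b w.
  by move/crossing_time_gtP : nT; apply; rewrite n1 leqnn.
elim: n {n1} => [|n nT].
  by apply/crossing_time_gtP => k /andP[k1 /(leq_trans k1)].
suff : [set v | n.+1%:R%:E < crossing_time M b v] w by [].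
rewrite crossing_time_gtS; split=> //=; rewrite ltNge; apply/negP => bM.
by apply: noT; exists n => //; rewrite crossing_time_eqS.
Qed.

Lemma trivIset_crossing_time_eqS :
  trivIset [set: nat] (fun n => [set w | crossing_time M b w = n.+1%:R%:E]).
Proof.
by move=> i j _ _ [w [/= -> []]] /eqP; rewrite eqr_nat => /eqP[].
Qed.

Lemma stopped_crossing_time_ge w :
  crossing_time M b w < +oo -> (b <= stopped M (crossing_time M b) w)%R.
Proof.
move=> Tfin; have : [set v | crossing_time M b v < +oo] w by [].
rewrite crossing_time_ltyE => -[n _ /= Tn].
rewrite (stoppedE _ Tn).
by move/crossing_time_finP : Tn => [].
Qed.

End crossing_events.

Lemma overshoot_ge0 d (T : measurableType d) (R : realType)
    (P : probability T R) (M : nat -> T -> R) (b : R) : 0 <= overshoot P M b.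
Proof.
rewrite /overshoot /expectation_given; case: ifPn => // _.
rewrite expectation_mul_indic mule_ge0 ?inve_ge0// integral_ge0// => w.
by rewrite lee_fin subr_ge0; exact: stopped_crossing_time_ge.
Qed.

(** * Balance of mass for the stopped supermartingale *)

Section stopped_supermartingale.
Context d (T : measurableType d) (R : realType) (P : probability T R).
Variables (F : nat -> set (set T)) (M : nat -> T -> R) (b : R).
Hypothesis HM : nonneg_supermartingale P F M.
Let tau := crossing_time M b.
Let sF n : sub_sigma_algebra_of (F n) := (supermartingale_filtration HM).1 n.
Let M_ge0 := supermartingale_ge0 HM.

Lemma measurable_supermartingale n : measurable_fun [set: T] (M n).
Proof.
apply: (measurable_wrt_measurable (sF n)).
exact: (supermartingale_adapted HM).
Qed.

Let mM := measurable_supermartingale.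

Let iM n : P.-integrable [set: T] (EFin \o M n).
Proof.
apply/integrableP; split; first exact/measurable_EFinP.
have := supermartingale_expectation HM n; rewrite unlock.
by under eq_integral do rewrite /= -[M n _]ger0_norm//.
Qed.

(** T_b is a stopping time; this is what allows the conditional expectation
    given F_n to be integrated over {n < T_b}. *)
Lemma filtration_crossing_time_gt n : F n [set w | n%:R%:E < tau w].
Proof.
have FE k A : F k A = (F k).-sigma.-measurable A.
  by rewrite measurable_g_measurableTypeE//; case: (sF k).
elim: n => [|n Fn]; rewrite FE.
  rewrite (_ : [set _ | _] = setT); first exact: measurableT.
  apply/seteqP; split=> // w _ /=; apply/crossing_time_gtP => k.
  by move=> /andP[k1 /(leq_trans k1)].
rewrite /tau crossing_time_gtS; apply: measurableI.
  by rewrite -FE; apply: ((supermartingale_filtration HM).2 n n.+1).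
have mwrt : measurable_wrt (F n.+1) (M n.+1).
  exact: (supermartingale_adapted HM).
have := mwrt measurableT _ (@measurable_itv R `]-oo, b[).
by rewrite setTI preimage_itvNyo.
Qed.

Lemma measurable_crossing_time_gt n : measurable [set w | n%:R%:E < tau w].
Proof. exact: (sF n).2 (filtration_crossing_time_gt n). Qed.

Let mgt := measurable_crossing_time_gt.

Let meqS n : measurable [set w | tau w = n.+1%:R%:E].
Proof.
rewrite /tau crossing_time_eqS; apply: measurableI; first exact: mgt.
have := mM n.+1 measurableT (@measurable_itv R `[b, +oo[).
by rewrite setTI preimage_itvcy.
Qed.

Lemma measurable_crossing_time_lty : measurable [set w | tau w < +oo].
Proof. by rewrite /tau crossing_time_ltyE; exact: bigcup_measurable. Qed.

Let mlty := measurable_crossing_time_lty.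

Let mstopped :
  measurable_fun [set w | tau w < +oo] (stopped M tau).
Proof.
rewrite /tau crossing_time_ltyE; apply/measurable_fun_bigcup => // n.
apply: (eq_measurable_fun (M n.+1)).
  by move=> w; rewrite inE => /stoppedE ->.
exact: measurable_funS (mM _).
Qed.

Lemma expectation_stopped_series :
  'E_P[fun w => (stopped M tau w * \1_[set v | (tau v < +oo)%E] w)%R] =
  \sum_(0 <= n <oo) \int[P]_(w in [set w | tau w = n.+1%:R%:E]) (M n.+1 w)%:E.
Proof.
rewrite expectation_mul_indic /tau crossing_time_ltyE ge0_integral_bigcup//.
- apply: eq_eseriesr => n _; apply: eq_integral => w.
  by rewrite inE => /stoppedE ->.
- by rewrite -crossing_time_ltyE; exact/measurable_EFinP.
- by move=> w _; rewrite lee_fin; exact: M_ge0.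
- exact: trivIset_crossing_time_eqS.
Qed.

(** Over {n < T}, which lies in F_n, the conditional expectation of M_{n+1}
    integrates like M_{n+1} itself, so the mean decrement is the mean of M_n
    minus that of M_{n+1}; the latter splits along whether T = n+1. *)
Lemma stopping_balance n :
  \int[P]_(w in [set w | n%:R%:E < tau w]) (M n w)%:E =
  \int[P]_(w in [set w | n.+1%:R%:E < tau w]) (M n.+1 w)%:E +
  \int[P]_(w in [set w | tau w = n.+1%:R%:E]) (M n.+1 w)%:E +
  'E_P[fun w => (decrement P F M n.+1 w *
                 \1_[set v | (n.+1%:R%:E <= tau v)%E] w)%R].
Proof.
have [mC iC CE] := cond_expP (sF n) (iM n.+1).
have iS (A : set T) (f : T -> R) : measurable A ->
    P.-integrable [set: T] (EFin \o f) -> P.-integrable A (EFin \o f).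
  by move=> mA; exact: integrableS.
have -> : [set v | n.+1%:R%:E <= tau v] = [set v | n%:R%:E < tau v].
  by apply/seteqP; split=> w /=; rewrite /tau crossing_time_geS.
rewrite expectation_mul_indic.
under [X in _ = _ + X]eq_integral do rewrite /decrement EFinB.
rewrite integralB_EFin; [|exact: mgt|by apply: iS|by apply: iS].
rewrite CE; last exact: filtration_crossing_time_gt.
have UE : [set w | n%:R%:E < tau w] =
    [set w | n.+1%:R%:E < tau w] `|` [set w | tau w = n.+1%:R%:E].
  rewrite /tau crossing_time_gtS crossing_time_eqS -setIUr.
  rewrite (_ : _ `|` _ = setT) ?setIT//; apply/seteqP; split=> // w _ /=.
  by case: (ltP (M n.+1 w) b); [left|right].
have dis : [disjoint [set w | n.+1%:R%:E < tau w] &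
    [set w | tau w = n.+1%:R%:E]].
  apply/disj_setPS => w /= [tauw tauE]; by move: tauw; rewrite tauE ltxx.
rewrite -ge0_integral_setU//; last 2 first.
- by apply: measurable_funTS; exact/measurable_EFinP.
- by move=> w _; rewrite lee_fin.
rewrite -UE addeC subeK//.
by apply: integrable_fin_num => //; exact: iS.
Qed.

(** M_T = b + (M_T - b), where both terms are nonnegative on {T < oo}, so the
    identity holds in the extended reals even if the overshoot is infinite. *)
Lemma expectation_stopped_overshoot : (0 <= b)%R ->
  'E_P[fun w => (stopped M tau w * \1_[set v | (tau v < +oo)%E] w)%R] =
  P [set w | tau w < +oo] * (b%:E + overshoot P M b).
Proof.
move=> b0; rewrite expectation_mul_indic.
rewrite /overshoot /expectation_given -/tau; case: ifPn => [/eqP PA0|PA0].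
  rewrite PA0 mul0e null_set_integral//; exact/measurable_EFinP.
rewrite expectation_mul_indic ge0_muleDr ?lee_fin//; last first.
  rewrite mule_ge0 ?inve_ge0// integral_ge0// => w /stopped_crossing_time_ge.
  by rewrite lee_fin subr_ge0.
rewrite muleCA divee ?fin_num_measure// mule1.
rewrite (eq_integral (fun w => b%:E + (stopped M tau w - b)%:E)); last first.
  by move=> w _; rewrite -EFinD addrC subrK.
rewrite ge0_integralD//.
- by rewrite integral_cst// muleC.
- by move=> w /stopped_crossing_time_ge; rewrite lee_fin subr_ge0.
- by apply/measurable_EFinP; exact: measurable_funB.
Qed.

(** Sum of the one-step balances.  The total is written as a difference of
    finite quantities so that each part can be sent to its limit. *)
Lemma loss_balance n :
  \sum_(1 <= i < n.+1) 'E_P[fun w => (decrement P F M i w *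
      \1_[set v | (i%:R%:E <= tau v)%E] w)%R] =
  'E_P[M 0%N] -
  (\sum_(0 <= k < n) \int[P]_(w in [set w | tau w = k.+1%:R%:E]) (M k.+1 w)%:E +
   'E_P[fun w => (M n w * \1_[set v | (n%:R%:E < tau v)%E] w)%R]).
Proof.
have iS (A : set T) k : measurable A ->
    \int[P]_(w in A) (M k w)%:E \is a fin_num.
  by move=> mA; apply: integrable_fin_num => //; exact: integrableS (iM k).
rewrite expectation_mul_indic big_add1 /=.
elim: n => [|n IHn].
  rewrite !big_geq// add0e (_ : [set w | _] = setT).
    by rewrite unlock subee// iS.
  apply/seteqP; split=> // w _ /=; apply/crossing_time_gtP => k.
  by move=> /andP[k1 /(leq_trans k1)].
rewrite !big_nat_recr//= IHn stopping_balance.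
set e := 'E_P[M 0%N].
set l := 'E_P[_]; set h := \int[P]_(w in [set _ | _ = _]) _.
set a := \int[P]_(w in [set _ | _ < _]) _.
set s := \sum_(0 <= _ < _) _.
have afin : a \is a fin_num by exact: iS.
have hfin : h \is a fin_num by exact: iS.
have lfin : l \is a fin_num.
  suff -> : l = \int[P]_(w in [set w | n%:R%:E < tau w]) (M n w)%:E - (a + h).
    by rewrite fin_numB (iS _ n (mgt n)) fin_numD afin hfin.
  rewrite stopping_balance -/a -/h -/l [a + h + l]addeC addeK//.
  by rewrite fin_numD afin hfin.
have sfin : s \is a fin_num by apply/sum_fin_numP => k _ _; exact: iS.
have efin : e \is a fin_num by rewrite /e unlock; exact: iS.
(* All five terms are finite, so the step is an identity between reals. *)
rewrite -(fineK afin) -(fineK hfin) -(fineK lfin) -(fineK sfin) -(fineK efin).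
by rewrite -!EFinD; congr EFin; ring.
Qed.

End stopped_supermartingale.

Theorem theorem4p2 (d : measure_display) (T : measurableType d) (R : realType)
    (P : probability T R) (F : nat -> set (set T)) (M : nat -> T -> R) (b : R)
    (HM : nonneg_supermartingale P F M)
    (HM0 : forall w, M 0%N w = 1%R)
    (Hb : (1 < b)%R)
    (Hlim : {ae P, forall w, crossing_time M b w = +oo ->
               M n w @[n --> \oo] --> (0 : R)%R})
    (HUI : uniformly_integrable P (fun (n : nat) (w : T) =>
             M n w * \1_[set v | (n%:R%:E < crossing_time M b v)%E] w)%R)
    (HO : overshoot P M b < +oo) :
  'E_P[fun w => (stopped M (crossing_time M b) w *
                 \1_[set v | (crossing_time M b v < +oo)%E] w)%R]
    = 1 - loss P F M b
  /\
  P [set w | crossing_time M b w < +oo]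
    = (1 - loss P F M b) / (b%:E + overshoot P M b).
Proof.
have b0 : (0 < b)%R := lt_trans ltr01 Hb.
have M_ge0 := supermartingale_ge0 HM.
set A := [set w | crossing_time M b w < +oo].
set H := 'E_P[_].
have HE : H = P A * (b%:E + overshoot P M b).
  exact: expectation_stopped_overshoot HM (ltW b0).
have O_ge0 : 0 <= overshoot P M b.
  exact: overshoot_ge0.
have Ofin : b%:E + overshoot P M b \is a fin_num.
  by rewrite fin_numD/= ge0_fin_numE.
have mA : measurable A by exact: measurable_crossing_time_lty HM.
have Hfin : H \is a fin_num by rewrite HE fin_numM// fin_num_measure.
have residual_cvg0 : 'E_P[fun w =>
    (M n w * \1_[set v | (n%:R%:E < crossing_time M b v)%E] w)%R]
    @[n --> \oo] --> 0.
  under eq_fun => n do under eq_fun => w do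
    rewrite -[(_ * _)%R]ger0_norm ?mulr_ge0//.
  apply: uniformly_integrable_cvg0 HUI _.
    move=> n; apply: measurable_funM.
      exact: measurable_supermartingale HM n.
    by apply: measurable_indic; apply: (measurable_crossing_time_gt _ HM).
  apply: filterS Hlim => w M0.
  (* If T = oo the indicator is constantly 1; otherwise the product is 0 from
     time T on. *)
  have [Ty|Tfin] := eqVneq (crossing_time M b w) +oo.
    apply: cvg_trans (M0 Ty); apply: near_eq_cvg; apply: nearW => n /=.
    by rewrite indicE mem_set ?mulr1//= Ty ltry.
  have : A w by rewrite /A /= lt_neqAle Tfin leey.
  rewrite /A crossing_time_ltyE => -[N _ /= TN].
  apply: cvg_near_cst; exists N.+1 => // n /= Nn.
  rewrite indicE memNset ?mulr0//= TN lte_fin ltr_nat.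
  by apply/negP; rewrite -leqNgt.
have lossE : loss P F M b = 1 - H.
  apply/cvg_lim => //; rewrite -cvg_shiftS /=.
  under eq_fun => n do rewrite (loss_balance b HM).
  have -> : 'E_P[M 0%N] = 1.
    by rewrite -(expectation_cst P 1); congr expectation; apply/funext.
  have -> : H = H + 0 by rewrite adde0.
  apply: cvgeB; [by rewrite adde0 fin_num_adde_defl ?fin_numN|exact: cvg_cst|].
  apply: cvgeD residual_cvg0 => //; first by rewrite fin_num_adde_defr.
  rewrite /H (expectation_stopped_series b HM).
  apply: is_cvg_nneseries => n _ _; apply: integral_ge0 => w _.
  by rewrite lee_fin.
have -> : 1 - loss P F M b = H.
  by rewrite lossE -(fineK Hfin) -!EFinB; congr EFin; ring.
split=> //; rewrite HE -muleA divee ?mule1//.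
by rewrite gt_eqF// (lt_le_trans _ (leeDl _ O_ge0)).
Qed.
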